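(* Let $\mathsf{G}$ be a connected weighted graph on $n\ge 2$ vertices with Laplacian $A$, and let $\bm{\varphi}\in\mathbb{R}^n$, $\|\bm{\varphi}\|=1$, be a Fiedler vector of $A$. Let $\mathsf{G}_D$ be obtained from $\mathsf{G}$ by disaggregating the first $m$ vertices, the $i$-th of them into $d_i>1$ vertices, $i=1,\dots,m$; let $n_d=\sum_{k=1}^m d_k$ and $N=n-m+n_d$. Then $$\frac{a(\mathsf{G})}{a(\mathsf{G}_D)}\ \ge\ 1+\frac1N\sum_{i=1}^m(d_i-1)(n+n_d-md_i)\,\varphi_i^2 .$$
   Context: All graphs are finite, simple, undirected, with positive edge weights $\omega_e$. The Laplacian $A$ of $\mathsf{G}=(V,E,\omega)$ is the symmetric matrix with $\langle A\bm{u},\bm{v}\rangle=\sum_{e=(i,j)\in E}\omega_e(u_i-u_j)(v_i-v_j)$. For a connected graph the eigenvalues are $0=\lambda_1<\lambda_2\le\cdots$; the algebraic connectivity is $a(\mathsf{G})=\lambda_2$, and a Fiedler vector is an eigenvector for $\lambda_2$. $\|\cdot\|$ is the Euclidean norm. Disaggregating the vertices $1,\dots,m$ of $\mathsf{G}$ into $d_1,\dots,d_m$ vertices: vertex $k\le m$ is replaced by a set $V_a^k$ of $d_k$ new vertices, and the remaining $n-m$ vertices are kept, so the new graph $\mathsf{G}_D$ has $N=n-m+\sum_k d_k$ vertices. Each edge of $\mathsf{G}$ gives exactly one edge of $\mathsf{G}_D$ of the same weight, where any endpoint $k\le m$ is replaced by one (arbitrarily chosen) vertex of $V_a^k$; in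 addition an arbitrary connected graph with positive edge weights is placed on each $V_a^k$. Thus $\mathsf{G}_D$ is connected. *)

(* Defs.v *)
From mathcomp Require Import all_boot all_order all_algebra.
From mathcomp Require Import polyrcf ring.

Set Implicit Arguments.
Unset Strict Implicit.
Unset Printing Implicit Defensive.

Import Order.TTheory GRing.Theory Num.Theory.
Local Open Scope ring_scope.

(* [weight] is only meaningful on edges: its values on non-adjacent pairs are
   never used. *)
Record wgraph (R : numDomainType) (n : nat) := WGraph {
  edge : rel 'I_n;
  weight : 'I_n -> 'I_n -> R;
  edge_sym : symmetric edge;
  edge_irr : irreflexive edge;
  weight_sym : forall i j, weight i j = weight j i;
  weight_gt0 : forall i j, edge i j -> 0 < weight i j
}.

Definition gconnected (R : numDomainType) (n : nat) (G : wgraph R n) : Prop :=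
  forall i j, connect (edge G) i j.

(* Every unordered edge is counted once, through its orientation i < j. *)
Definition lap_form (R : numDomainType) (n : nat) (G : wgraph R n)
    (u v : 'rV[R]_n) : R :=
  \sum_(i < n) \sum_(j < n | (i < j)%N && edge G i j)
     weight G i j * (u 0 i - u 0 j) * (v 0 i - v 0 j).

(* The matrix of the bilinear form [lap_form]; see [laplacianP]. *)
Definition laplacian (R : numDomainType) (n : nat) (G : wgraph R n) : 'M[R]_n :=
  \matrix_(i, j) lap_form G (delta_mx 0 i) (delta_mx 0 j).

(* The roots of the characteristic polynomial in increasing order, each one
   repeated according to its multiplicity; see [spectrumP]. *)
Definition spectrum (R : rcfType) (n : nat) (A : 'M[R]_n) : seq R :=
  flatten [seq nseq (mup x (char_poly A)) x | x <- rootsR (char_poly A)].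

(* The second smallest eigenvalue (indexing starts at 0). *)
Definition alg_connectivity (R : rcfType) (n : nat) (G : wgraph R n) : R :=
  (spectrum (laplacian G))`_1.

(* Vectors are rows; the Laplacian being symmetric, its left and right
   eigenvectors are the same. *)
Definition fiedler_vector (R : rcfType) (n : nat) (G : wgraph R n)
    (phi : 'rV[R]_n) : Prop :=
  phi != 0 /\ (phi <= eigenspace (laplacian G) (alg_connectivity G))%MS.

Definition enorm (R : rcfType) (n : nat) (u : 'rV[R]_n) : R :=
  Num.sqrt (\sum_(i < n) u 0 i ^+ 2).

(* The number of new vertices standing for vertex k of the original graph:
   d k for the m first vertices, and 1 for those that are kept. *)
Definition fibre_size (m n : nat) (d : 'I_m -> nat) (k : 'I_n) : nat :=
  if insub (val k) is Some i then d i else 1%N.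

(* [p] sends each vertex of GD to the vertex of G it comes from, so that
   V_a^k is the fibre of [p] at k, and [rep k l] is the vertex of that fibre
   chosen to replace the endpoint k of the edge {k, l}.  The edges of GD inside
   a fibre are only required to connect it. *)
Definition disaggregation (R : numDomainType) (m n N : nat) (d : 'I_m -> nat)
    (G : wgraph R n) (GD : wgraph R N) : Prop :=
  exists (p : 'I_N -> 'I_n) (rep : 'I_n -> 'I_n -> 'I_N),
    [/\ forall k, #|[set x | p x == k]| = fibre_size d k,
        forall k l, edge G k l -> p (rep k l) = k,
        forall x y, p x != p y ->
          edge GD x y = [&& edge G (p x) (p y), x == rep (p x) (p y)
                          & y == rep (p y) (p x)],
        forall k l, edge G k l ->
          weight GD (rep k l) (rep l k) = weight G k l
      & forall x y, p x = p y ->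
          connect [rel u v | edge GD u v && (p u == p v)] x y].

Lemma lap_formE (R : numDomainType) (n : nat) (G : wgraph R n)
    (u v : 'rV[R]_n) :
  lap_form G u v = \sum_k \sum_l u 0 k * v 0 l
                     * lap_form G (delta_mx 0 k) (delta_mx 0 l).
Proof.
have coordE (w : 'rV[R]_n) (i : 'I_n) : w 0 i = \sum_k w 0 k * (delta_mx 0 k : 'rV[R]_n) 0 i.
  rewrite (bigD1 i) //= mxE !eqxx mulr1 big1 ?addr0 // => k ki.
  by rewrite mxE eqxx eq_sym (negPf ki) mulr0.
have diffE (w : 'rV[R]_n) (i j : 'I_n) :
    w 0 i - w 0 j = \sum_k
        w 0 k * ((delta_mx 0 k : 'rV[R]_n) 0 i - (delta_mx 0 k : 'rV[R]_n) 0 j).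
  rewrite (coordE w i) (coordE w j) -sumrB.
  by apply: eq_bigr => k _; rewrite mulrBr.
rewrite /lap_form; under [RHS]eq_bigr => k _.
  under eq_bigr => l _ do rewrite mulr_sumr.
  rewrite exchange_big; over.
rewrite exchange_big; apply: eq_bigr => i _ /=.
under [RHS]eq_bigr => k _.
  under eq_bigr => l _ do rewrite mulr_sumr.
  rewrite exchange_big; over.
rewrite exchange_big; apply: eq_bigr => j _ /=.
rewrite (diffE u) (diffE v) -mulrA big_distrlr mulr_sumr; apply: eq_bigr => k _.
rewrite mulr_sumr; apply: eq_bigr => l _.
by rewrite /=; ring.
Qed.

Lemma laplacianP (R : numDomainType) (n : nat) (G : wgraph R n)
    (u v : 'rV[R]_n) :
  (u *m laplacian G *m v^T) 0 0 = lap_form G u v.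
Proof.
rewrite lap_formE -mulmxA mxE; apply: eq_bigr => k _.
rewrite mxE mulr_sumr; apply: eq_bigr => l _.
by rewrite !mxE; ring.
Qed.

Lemma laplacian_sym (R : numDomainType) (n : nat) (G : wgraph R n) :
  (laplacian G)^T = laplacian G.
Proof.
apply/matrixP => i j; rewrite !mxE; apply: eq_bigr => k _.
by apply: eq_bigr => l _; rewrite mulrAC.
Qed.

Lemma spectrumP (R : rcfType) (n : nat) (A : 'M[R]_n) (s : seq R) :
  sorted <=%R s -> char_poly A = \prod_(x <- s) ('X - x%:P) ->
  spectrum A = s.
Proof.
move=> s_sorted charE; have char_neq0 : char_poly A != 0.
  by rewrite monic_neq0 ?char_poly_monic.
have rootE x : (x \in rootsR (char_poly A)) = root (char_poly A) x.
  by rewrite -roots_on_rootsR // in_itv.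
have sortedF (f : R -> nat) (r : seq R) : sorted <%R r ->
    sorted <=%R (flatten [seq nseq (f x) x | x <- r]).
  rewrite (sorted_pairwise lt_trans) (sorted_pairwise le_trans).
  elim: r => //= x r IHr /andP[xr /IHr r_sorted].
  rewrite pairwise_cat r_sorted andbT; apply/andP; split.
    apply/allrelP => y z /nseqP[-> _] /flattenP[t /mapP[z' z'r ->]].
    by move=> /nseqP[-> _]; apply/ltW/(allP xr).
  by elim: (f x) => //= k ->; rewrite andbT; apply/allP => y /nseqP[-> _].
apply: (sorted_eq le_trans le_anti) => //; first exact/sortedF/sorted_roots.
apply/allP => x _ /=; apply/eqP.
have -> : count_mem x s = mup x (char_poly A) by rewrite charE mu_prod_XsubC.
have countE y : count_mem x (nseq (mup y (char_poly A)) y)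
                = if y == x then mup x (char_poly A) else 0%N.
  by rewrite count_nseq /=; case: eqP => [->|_]; rewrite ?mul1n.
rewrite /spectrum count_flatten sumnE !big_map.
rewrite (eq_bigr _ (fun y _ => countE y)) -big_mkcond /= big_const_seq.
rewrite iter_addn_0.
have r_uniq : uniq (rootsR (char_poly A)).
  exact/(sorted_uniq lt_trans ltxx)/sorted_roots.
rewrite count_uniq_mem // rootE.
by case: (boolP (root _ x)) => [_|/mupNroot ->]; rewrite ?muln1.
Qed.

(* Main.v *)
(** Let [u] be the vector on the vertices of [GD] that takes the value of [phi]
    at k on the whole fibre of k.  Edges inside a fibre contribute nothing to
    the energy of [u], so it equals the energy [a(G)] of [phi].  Since [a(GD)]
    bounds the Rayleigh quotient of any vector orthogonal to 1 from below,
    [a(GD) (|u|^2 - (sum u)^2 / N) <= a(G)].  As [sum phi = 0], the sum of [u]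
    is [sum_i (d_i - 1) phi_i], and Cauchy-Schwarz on these m terms gives the
    claim.  The Rayleigh bound comes from the unitary diagonalization of the
    Laplacian over [R[i]], where connectedness makes the eigenvalue 0 simple. *)

Require Import Defs.
From mathcomp Require Import all_boot all_order all_algebra.
From mathcomp Require Import complex ring.

Set Implicit Arguments.
Unset Strict Implicit.
Unset Printing Implicit Defensive.

Import Order.TTheory GRing.Theory Num.Theory.
Local Open Scope ring_scope.

Local Notation "M ^t*" := (map_mx Num.conj (trmx M)) (at level 30).

(** * Energy as a sum over ordered pairs *)

Lemma edge_neq (R : numDomainType) (n : nat) (G : wgraph R n) (k l : 'I_n) :
  edge G k l -> k != l.
Proof. by apply: contraTneq => ->; rewrite edge_irr. Qed.

(** Swapping the endpoints changes the sign of both differences, so each edge gives the same term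
    twice. This form ignores the order on the vertices, which a map between vertex sets need not
    preserve. *)
Lemma lap_form_sum2 (R : numDomainType) (n : nat) (G : wgraph R n)
    (u v : 'rV[R]_n) :
  lap_form G u v *+ 2 = \sum_i \sum_(j | edge G i j)
    weight G i j * (u 0 i - u 0 j) * (v 0 i - v 0 j).
Proof.
have -> : \sum_i \sum_(j | edge G i j)
      weight G i j * (u 0 i - u 0 j) * (v 0 i - v 0 j)
    = lap_form G u v + \sum_(i < n) \sum_(j < n | (j < i)%N && edge G i j)
      weight G i j * (u 0 i - u 0 j) * (v 0 i - v 0 j).
  rewrite /lap_form -big_split; apply: eq_bigr => i _ /=.
  rewrite (bigID (fun j : 'I_n => (i < j)%N)) /=; congr (_ + _).
    by apply: eq_bigl => j; rewrite andbC.
  apply: eq_bigl => j; rewrite andbC -leqNgt leq_eqVlt.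
  by have [/val_inj ->|] //= := eqVneq (val j) (val i); rewrite edge_irr ltnn.
rewrite mulr2n; congr (_ + _); rewrite /lap_form.
rewrite (exchange_big_dep predT) //=; apply: eq_bigr => i _.
apply: eq_big => [j|j _]; first by rewrite edge_sym.
by rewrite weight_sym; ring.
Qed.

Lemma lap_form_const (R : numDomainType) (n : nat) (G : wgraph R n)
    (u : 'rV[R]_n) (c : R) : lap_form G u (const_mx c) = 0.
Proof.
rewrite /lap_form big1 // => i _; rewrite big1 // => j _.
by rewrite !mxE subrr mulr0.
Qed.

(** * Unitary diagonalization of the Laplacian of a connected graph *)

Section Hermitian.
Variables (C : numClosedFieldType) (n : nat) (G : wgraph C n).

Lemma laplacian_real : laplacian G \is a mxOver Num.real.
Proof.
apply/mxOverP => i j; rewrite mxE; apply: sum_real => k _.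
apply: sum_real => l /andP[_ /weight_gt0/gtr0_real w_real].
by rewrite !rpredM ?rpredB // !mxE; apply: rpred_nat.
Qed.

Lemma laplacian_normal : laplacian G \is normalmx.
Proof.
by apply/normalmxP; rewrite laplacian_sym (realmxC laplacian_real).
Qed.

Lemma laplacian_conjP (u : 'rV[C]_n) :
  (u *m laplacian G *m u^t*) 0 0 = lap_form G u (map_mx Num.conj u).
Proof. by rewrite -laplacianP map_trmx. Qed.

Lemma lap_form_conj_ge0 (u : 'rV[C]_n) : 0 <= lap_form G u (map_mx Num.conj u).
Proof.
apply: sumr_ge0 => i _; apply: sumr_ge0 => j /andP[_ /weight_gt0/ltW w_ge0].
by rewrite -mulrA !mxE -rmorphB mulr_ge0 // mul_conjC_ge0.
Qed.

(** Every edge term is nonnegative, so each one vanishes; [u] is then equal at the two ends of each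
    edge, hence along any path. *)
Lemma lap_form_conj_eq0 (u : 'rV[C]_n) : gconnected G ->
  lap_form G u (map_mx Num.conj u) = 0 -> forall i j, u 0 i = u 0 j.
Proof.
move=> G_conn u0 i j.
have term_ge0 (k l : 'I_n) : edge G k l -> 0 <= weight G k l
    * (u 0 k - u 0 l) * ((map_mx Num.conj u) 0 k - (map_mx Num.conj u) 0 l).
  move=> /weight_gt0/ltW w_ge0.
  by rewrite -mulrA !mxE -rmorphB mulr_ge0 // mul_conjC_ge0.
have edge_eq k l : edge G k l -> u 0 k = u 0 l.
  move=> kl; have : lap_form G u (map_mx Num.conj u) *+ 2 = 0.
    by rewrite u0 mul0rn.
  rewrite lap_form_sum2 => /psumr_eq0P sum0; apply/eqP; rewrite -subr_eq0.
  have {sum0}/psumr_eq0P/(_ _ kl) :=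
    sum0 (fun k _ => sumr_ge0 _ (term_ge0 k)) k isT.
  move=> /(_ (term_ge0 k))/eqP.
  by rewrite -mulrA !mxE -rmorphB mulf_eq0 mul_conjC_eq0 gt_eqF ?weight_gt0.
have /connectP[p pi ->] := G_conn i j.
elim: p i pi => //= k p IHp i /andP[ik /IHp <-]; exact: edge_eq.
Qed.

(** The rows of [P] are orthonormal eigenvectors. The eigenvalue 0 occurs at the index [k] alone,
    with a constant eigenvector, so vectors with zero sum have no component along it. *)
Lemma laplacian_spectral : gconnected G -> (0 < n)%N ->
  exists (P : 'M[C]_n) (D : 'rV[C]_n) (k : 'I_n),
    [/\ P \is unitarymx, laplacian G = P^t* *m diag_mx D *m P,
        D 0 k = 0, forall i, i != k -> 0 < D 0 i
      & forall j, P k j = P k k].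
Proof.
move=> G_conn n_gt0; set L := laplacian G.
pose P := spectralmx L; pose D := spectral_diag L.
have P_unit : P \is unitarymx := spectral_unitarymx L.
have LE : L = P^t* *m diag_mx D *m P.
  by rewrite -invmx_unitary //; apply/orthomx_spectralP/laplacian_normal.
have PP := unitarymxP P_unit.
have dotE i j : \sum_l P i l * (P j l)^* = (i == j)%:R.
  have /matrixP/(_ i j) := PP; rewrite !mxE => <-.
  by apply: eq_bigr => l _; rewrite !mxE.
(* An eigenvalue is the energy of its unit eigenvector: it is nonnegative, and zero only if the row
   is constant. *)
have DE i : D 0 i = lap_form G (row i P) (map_mx Num.conj (row i P)).
  rewrite -laplacian_conjP -/L -row_mul LE !mulmxA PP mul1mx.
  rewrite row_mul row_diag_mx -!scalemxAl -rowE mxE mxE.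
  under eq_bigr => l _ do rewrite !mxE.
  by rewrite dotE eqxx mulr1.
have constP i : D 0 i = 0 -> forall l l', P i l = P i l'.
  move=> Di0 l l'; rewrite DE in Di0.
  by have := lap_form_conj_eq0 G_conn Di0 l l'; rewrite !mxE.
(* Two nonzero constant rows cannot be orthogonal. *)
have uniqk i k : D 0 i = 0 -> D 0 k = 0 -> i = k.
  move=> Di0 Dk0; apply/eqP/negPn/negP => ik.
  have c_neq0 j : D 0 j = 0 -> P j k != 0.
    move=> Dj0; apply/negP => /eqP Pj0; have := dotE j j.
    rewrite eqxx big1 => [/esym/eqP|l _]; first by rewrite oner_eq0.
    by rewrite (constP j Dj0 l k) Pj0 mul0r.
  have := dotE i k; rewrite (negPf ik) mulr0n.
  under eq_bigr => l _ do rewrite (constP i Di0 l k) (constP k Dk0 l k).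
  move=> /eqP; rewrite sumr_const card_ord -mulr_natr !mulf_eq0 /= conjC_eq0.
  by rewrite (negPf (c_neq0 i Di0)) (negPf (c_neq0 k Dk0)) pnatr_eq0 gtn_eqF.
(* The all-ones vector [u] is in the kernel of [L], so each of its coordinates [w] is killed by the
   matching eigenvalue; some coordinate is nonzero. *)
have [k Dk0] : exists k, D 0 k = 0.
  pose u : 'rV[C]_n := const_mx 1; pose w := u *m P^t*.
  have uL : u *m L = 0.
    apply/rowP => j; have := laplacianP G (delta_mx 0 j) u.
    rewrite lap_form_const -rowE mxE => lap0.
    rewrite [RHS]mxE -lap0 mxE.
    apply: eq_bigr => i _; rewrite [row j _ 0 i]mxE [u^T _ _]mxE mulrC.
    by rewrite -[L in LHS](laplacian_sym G) [in LHS]mxE.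
  have wD i : w 0 i * D 0 i = 0.
    have /rowP/(_ i) : w *m diag_mx D = 0.
      rewrite -(mulmx1 (w *m _)) -PP mulmxA.
      by rewrite /w -(mulmxA u) -(mulmxA u) -LE uL mul0mx.
    by rewrite mul_mx_diag !mxE.
  have : w != 0.
    apply/negP => /eqP w0; have : u = w *m P.
      by rewrite /w mulmxKtV.
    rewrite w0 mul0mx => /rowP/(_ (Ordinal n_gt0)); rewrite !mxE => /eqP.
    by rewrite oner_eq0.
  move=> /rV0Pn[k wk]; exists k; have /eqP := wD k.
  by rewrite mulf_eq0 (negPf wk) => /eqP.
exists P, D, k; split=> // [i ik|j]; last exact: constP.
rewrite lt0r DE lap_form_conj_ge0 andbT -DE.
by apply: contra ik => /eqP Di0; apply/eqP/uniqk.
Qed.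

End Hermitian.

(** * Passage from [R] to its algebraic closure [R[i]] *)

Local Notation toC := (real_complex _).

Section Complexification.
Variables (R : rcfType) (n : nat) (G : wgraph R n).

Lemma complex_weight_sym i j : toC (weight G i j) = toC (weight G j i).
Proof. by rewrite weight_sym. Qed.

Lemma complex_weight_gt0 i j : edge G i j -> 0 < toC (weight G i j).
Proof. by rewrite ltcR; apply: weight_gt0. Qed.

Definition complex_graph : wgraph R[i] n :=
  WGraph (edge_sym G) (edge_irr G) complex_weight_sym complex_weight_gt0.

Lemma lap_form_complex (u v : 'rV[R]_n) :
  lap_form complex_graph (map_mx toC u) (map_mx toC v) = toC (lap_form G u v).
Proof.
rewrite /lap_form rmorph_sum; apply: eq_bigr => i _.
rewrite rmorph_sum; apply: eq_bigr => j _.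
by rewrite !mxE !rmorphM !rmorphB.
Qed.

Lemma laplacian_complex : laplacian complex_graph = map_mx toC (laplacian G).
Proof.
by apply/matrixP => i j; rewrite !mxE -lap_form_complex !map_delta_mx.
Qed.

Lemma conj_complex (u : 'rV[R]_n) :
  map_mx Num.conj (map_mx toC u) = map_mx toC u.
Proof.
apply/rowP => j; rewrite !mxE; apply: conj_Creal.
by apply/complex_realP; exists (u 0 j).
Qed.

End Complexification.

(** * The second smallest eigenvalue and the Rayleigh bound *)

Lemma char_poly_unitary (C : numClosedFieldType) (n : nat) (P : 'M[C]_n)
    (D : 'rV[C]_n) :
  P \is unitarymx ->
  char_poly (P^t* *m diag_mx D *m P) = \prod_(i < n) ('X - (D 0 i)%:P).
Proof.
move=> P_unit; have PP : P^t* *m P = 1%:M by apply/mulmx1C/unitarymxP.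
transitivity (char_poly (diag_mx D)); last first.
  rewrite char_poly_trig ?diag_mx_is_trig //.
  by apply: eq_bigr => i _; rewrite mxE eqxx.
rewrite /char_poly /char_poly_mx !map_mxM.
have PPp : map_mx polyC (P^t* ) *m map_mx polyC P = 1%:M.
  by rewrite -map_mxM PP map_mx1.
(* With ['X%:M] written as a conjugate too, [P] and its adjoint factor out of the determinant and
   cancel. *)
have XE : 'X%:M = map_mx polyC (P^t* ) *m 'X%:M *m map_mx polyC P.
  by rewrite scalar_mxC -mulmxA PPp mulmx1.
rewrite [in LHS]XE -mulmxBl -mulmxBr !det_mulmx mulrAC -det_mulmx PPp det1.
by rewrite mul1r.
Qed.

(** Once the minimum [d k] is taken off, entry 1 of the spectrum is the minimum over the other
    indices. Removing an index rather than a value respects multiplicities. *)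
Lemma spectrum1P (R : rcfType) (n : nat) (A : 'M[R]_n) (d : 'I_n -> R)
    (k : 'I_n) :
  char_poly A = \prod_(i < n) ('X - (d i)%:P) -> (forall i, d k <= d i) ->
  (1 < n)%N ->
  (exists2 i, i != k & (spectrum A)`_1 = d i)
  /\ (forall i, i != k -> (spectrum A)`_1 <= d i).
Proof.
move=> charE dk n_gt1.
pose r := rem k (enum 'I_n); pose s := sort <=%R (map d r).
have enum_k : perm_eq (enum 'I_n) (k :: r) by rewrite perm_to_rem ?mem_enum.
have memr i : (i \in r) = (i != k).
  by rewrite mem_rem_uniq ?enum_uniq // inE mem_enum andbT.
have mems x : (x \in s) = (x \in map d r) by rewrite mem_sort.
have s_sorted : sorted <=%R s by exact/sort_sorted/le_total.
have specE : spectrum A = d k :: s.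
  apply: spectrumP.
    rewrite /= path_min_sorted //; apply/allP => x.
    by rewrite mems => /mapP[i _ ->].
  rewrite charE -big_enum /= (perm_big _ enum_k) /= !big_cons; congr (_ * _).
  by rewrite (perm_big _ (permEl (perm_sort _ _))) big_map.
rewrite specE /=.
(* Since [1 < n], the head of [s] is a genuine value and not the default of [nth]. *)
have s_gt0 : (0 < size s)%N.
  rewrite size_sort size_map size_rem ?mem_enum // -cardE card_ord.
  by rewrite -subn1 subn_gt0.
have /mapP[i ir s0] : s`_0 \in map d r by rewrite -mems mem_nth.
rewrite memr in ir; split; first by exists i.
move=> j jk; have : d j \in s by rewrite mems map_f // memr.
case/(nthP 0) => l l_lt <-.
by apply: (sorted_leq_nth le_trans le_refl); rewrite ?inE.
Qed.

(** In the eigenbasis over [R[i]], a vector with zero sum has no coordinate along the constants, and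
    every other eigenvalue is at least the algebraic connectivity. *)
Lemma alg_connectivityP (R : rcfType) (n : nat) (G : wgraph R n) :
  gconnected G -> (1 < n)%N ->
  0 < alg_connectivity G /\
  forall v : 'rV[R]_n, \sum_i v 0 i = 0 ->
    alg_connectivity G * \sum_i v 0 i ^+ 2 <= lap_form G v v.
Proof.
move=> G_conn n_gt1.
have [P [D [k [P_unit LE Dk0 D_gt0 Pk]]]] :=
  @laplacian_spectral _ _ (complex_graph G) G_conn (ltnW n_gt1).
have D_ge0 i : 0 <= D 0 i.
  by have [->|/D_gt0/ltW//] := eqVneq i k; rewrite Dk0.
(* The eigenvalues are nonnegative, hence real, so their real parts are the roots over [R]. *)
pose d i := complex.Re (D 0 i).
have dE i : toC (d i) = D 0 i by apply: RRe_real; exact: ger0_real.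
have charE : char_poly (laplacian G) = \prod_(i < n) ('X - (d i)%:P).
  apply: (@map_poly_inj _ _ toC); rewrite map_char_poly -laplacian_complex LE.
  rewrite char_poly_unitary // rmorph_prod; apply: eq_bigr => i _ /=.
  by rewrite rmorphB /= map_polyX map_polyC -dE.
have d_ge0 i : d k <= d i by rewrite -lecR !dE Dk0.
have [[i ik aE] a_le] := spectrum1P charE d_ge0 n_gt1.
rewrite -/(alg_connectivity G) in aE a_le *.
split; first by rewrite aE -ltcR dE; apply: D_gt0.
move=> v sum_v; pose w := map_mx toC v *m P^t*.
have conj_v : (map_mx toC v)^t* = (map_mx toC v)^T.
  by rewrite -map_trmx conj_complex.
(* Parseval, [w] being the coordinates of [v] in the eigenbasis. *)
have normE : toC (\sum_i v 0 i ^+ 2) = \sum_i `|w 0 i| ^+ 2.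
  have : (w *m w^t*) 0 0 = (map_mx toC v *m (map_mx toC v)^T) 0 0.
    rewrite /w trmx_mul map_mxM -/(_^t*) trmxCK conj_v mulmxA mulmxKtV //.
  rewrite 2!mxE => wv; rewrite rmorph_sum; apply: esym.
  etransitivity; last (etransitivity; [exact: wv|]); apply: eq_bigr => j _.
    by rewrite normCK !mxE.
  by rewrite !mxE rmorphXn expr2.
have formE : toC (lap_form G v v) = \sum_i D 0 i * `|w 0 i| ^+ 2.
  rewrite -lap_form_complex -{2}(conj_complex v) -laplacian_conjP LE.
  rewrite !mulmxA -(mulmxA _ P).
  have -> : P *m (map_mx toC v)^t* = w^t*.
    by rewrite /w trmx_mul map_mxM trmxCK.
  rewrite -/w.
  rewrite mxE; apply: eq_bigr => j _.
  by rewrite mul_mx_diag normCK !mxE; ring.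
(* Row [k] of [P] is constant, so this coordinate is a multiple of the sum of [v]. *)
have wk : w 0 k = 0.
  rewrite mxE.
  under eq_bigr => j _ do rewrite !mxE Pk.
  by rewrite -mulr_suml -rmorph_sum sum_v rmorph0 mul0r.
rewrite -lecR rmorphM /= normE formE mulr_sumr; apply: ler_sum => j _.
have [->|jk] := eqVneq j k; first by rewrite wk normr0 expr0n !mulr0.
by rewrite ler_wpM2r ?exprn_ge0 // -dE lecR a_le.
Qed.

(** * Energy and connectedness of the disaggregated graph *)

Section Disaggregation.
Variables (R : rcfType) (n N : nat).
Variables (G : wgraph R n) (GD : wgraph R N).
Variables (p : 'I_N -> 'I_n) (rep : 'I_n -> 'I_n -> 'I_N).
Hypothesis rep_fibre : forall k l, edge G k l -> p (rep k l) = k.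
Hypothesis edge_rep : forall x y, p x != p y ->
  edge GD x y = [&& edge G (p x) (p y), x == rep (p x) (p y)
                  & y == rep (p y) (p x)].
Hypothesis weight_rep : forall k l, edge G k l ->
  weight GD (rep k l) (rep l k) = weight G k l.
Hypothesis fibre_connected : forall x y, p x = p y ->
  connect [rel u v | edge GD u v && (p u == p v)] x y.

(** The pullback is constant on fibres, so edges inside a fibre carry no energy; the other edges
    correspond one to one to those of [G], with the same weights. *)
Lemma lap_form_pullback (u : 'rV[R]_n) :
  lap_form GD (\row_x u 0 (p x)) (\row_x u 0 (p x)) = lap_form G u u.
Proof.
suff : lap_form GD (\row_x u 0 (p x)) (\row_x u 0 (p x)) *+ 2
       = lap_form G u u *+ 2 by move/eqP; rewrite eqrMn2r // => /eqP.
rewrite !lap_form_sum2 !pair_big_dep /=.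
rewrite (bigID (fun xy => p xy.1 == p xy.2)) /=.
rewrite [X in X + _]big1 ?add0r; last first.
  by move=> xy /andP[_ /eqP pxy]; rewrite !mxE pxy subrr mulr0.
(* An ordered edge of [G] goes to the pair of its two chosen ends; applying [p] to both ends is the
   inverse. *)
rewrite (reindex_onto (fun kl => (rep kl.1 kl.2, rep kl.2 kl.1))
                      (fun xy => (p xy.1, p xy.2))) /=; last first.
  case=> x y /= /andP[xy pxy]; move: xy; rewrite edge_rep //.
  by case/and3P=> _ /eqP <- /eqP <-.
apply: eq_big => [[k l]|[k l]] /=; last first.
  move=> /andP[/andP[kl pkl] /eqP[pk pl]].
  rewrite !mxE weight_rep ?pk ?pl //.
  by move: kl; rewrite edge_rep // pk pl => /andP[].
have [kl|nkl] := boolP (edge G k l).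
  have lk : edge G l k by rewrite edge_sym.
  by rewrite edge_rep !rep_fibre ?(edge_neq kl) // kl !eqxx.
apply: contraNF nkl => /andP[/andP[kl pkl] /eqP[pk pl]].
by move: kl; rewrite edge_rep // pk pl => /andP[].
Qed.

(** A path of [G] is lifted edge by edge: within the fibre to the end chosen for the next edge, then
    across it. *)
Lemma disaggregation_connected : gconnected G -> gconnected GD.
Proof.
move=> G_conn x y.
have fibre a b : p a = p b -> connect (edge GD) a b.
  move=> /fibre_connected; apply: connect_sub => u v /andP[uv _].
  exact: connect1.
have /connectP[s] := G_conn (p x) (p y).
elim: s x => [|k s IHs] x /=; first by move=> _ /esym; apply: fibre.
case/andP=> pxk ks last_s.
have kpx : edge G k (p x) by rewrite edge_sym.
apply: (connect_trans (fibre x (rep (p x) k) _)); first by rewrite rep_fibre.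
apply: (connect_trans (connect1 (_ : edge GD _ (rep k (p x))))).
  by rewrite edge_rep !rep_fibre ?(edge_neq pxk) // pxk !eqxx.
by apply: IHs; rewrite rep_fibre.
Qed.

End Disaggregation.

(** * Sums over fibres and Cauchy-Schwarz *)

Lemma sum_fibre (R : pzSemiRingType) (N n : nat) (p : 'I_N -> 'I_n)
    (F : 'I_n -> R) :
  \sum_x F (p x) = \sum_k #|[set x | p x == k]|%:R * F k.
Proof.
rewrite (partition_big p predT) //=; apply: eq_bigr => k _.
rewrite (eq_bigr (fun=> F k)) => [|x /eqP -> //].
rewrite sumr_const mulr_natl; congr (_ *+ _).
by apply: eq_card => x; rewrite inE.
Qed.

(** Kept vertices have fibres of size 1, so only the first [m] indices contribute an excess. *)
Lemma sum_fibre_size (R : pzRingType) (m n : nat) (hmn : (m <= n)%N)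
    (d : 'I_m -> nat) (F : 'I_n -> R) :
  \sum_k (fibre_size d k)%:R * F k
    = \sum_k F k + \sum_(i < m) ((d i)%:R - 1) * F (widen_ord hmn i).
Proof.
apply/eqP; rewrite addrC -subr_eq -sumrB; apply/eqP.
rewrite (bigID (fun k : 'I_n => k < m)%N) /= [X in _ + X]big1 ?addr0.
  rewrite (big_ord_narrow hmn); apply: eq_bigr => i _.
  rewrite /fibre_size /= insubT //= => im; rewrite mulrBl mul1r.
  by congr ((d _)%:R * _ - _); apply: val_inj.
by move=> k km; rewrite /fibre_size insubN // mul1r subrr.
Qed.

(** Cauchy-Schwarz against the all-ones vector, by Lagrange's identity: the sum of all
    [(a i - a j) ^+ 2] is twice the gap. *)
Lemma sqr_sum_le (R : realFieldType) (m : nat) (a : 'I_m -> R) :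
  (\sum_i a i) ^+ 2 <= m%:R * \sum_i a i ^+ 2.
Proof.
have : 0 <= \sum_i \sum_j (a i - a j) ^+ 2.
  by apply: sumr_ge0 => i _; apply: sumr_ge0 => j _; apply: sqr_ge0.
suff -> : \sum_i \sum_j (a i - a j) ^+ 2
    = 2 * (m%:R * \sum_i a i ^+ 2 - (\sum_i a i) ^+ 2).
  by rewrite pmulr_rge0 // subr_ge0.
have -> : \sum_i \sum_j (a i - a j) ^+ 2
    = \sum_i \sum_j (a i ^+ 2 + a j ^+ 2 - 2 * (a i * a j)).
  by apply: eq_bigr => i _; apply: eq_bigr => j _; ring.
under eq_bigr => i _.
  rewrite sumrB big_split /= sumr_const card_ord -!mulr_sumr; over.
rewrite sumrB big_split /= -mulr_sumr -mulr_suml sumr_const card_ord.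
by rewrite sumrMnl -mulr_natl; ring.
Qed.

(** * Rayleigh quotient of the centred pullback of the Fiedler vector *)

Theorem theorem4 (R : rcfType) (m n : nat) (hmn : (m <= n)%N) (hn : (2 <= n)%N)
    (G : wgraph R n) (G_conn : gconnected G)
    (phi : 'rV[R]_n) (phi_norm : enorm phi = 1)
    (phi_fiedler : fiedler_vector G phi)
    (d : 'I_m -> nat) (hd : forall i, (1 < d i)%N) :
  let nd := (\sum_(k < m) d k)%N in
  let N := (n - m + nd)%N in
  forall GD : wgraph R N, disaggregation d G GD ->
  alg_connectivity G / alg_connectivity GD >=
    1 + N%:R^-1 * \sum_(i < m)
          ((d i)%:R - 1) * (n%:R + nd%:R - m%:R * (d i)%:R)
            * phi 0 (widen_ord hmn i) ^+ 2.
Proof.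
move=> nd N GD [p [rep [card_p rep_p edge_rep weight_rep conn_p]]].
(* Each [d i] is positive, hence [n <= N], and [GD] has at least two vertices as the Rayleigh bound
   requires. *)
have m_le_nd : (m <= nd)%N.
  by rewrite -{1}(card_ord m) -sum1_card leq_sum // => i _; apply: ltnW.
have n_le_N : (n <= N)%N by rewrite /N -{1}(subnK hmn) leq_add2l.
have N_gt0 : 0 < N%:R :> R by rewrite ltr0n (leq_trans _ n_le_N) // ltnW.
have NE : N%:R = n%:R - m%:R + nd%:R :> R by rewrite natrD natrB.
have [a_gt0 _] := alg_connectivityP G_conn hn.
have GD_conn := disaggregation_connected rep_p edge_rep conn_p G_conn.
have [b_gt0 b_le] := alg_connectivityP GD_conn (leq_trans hn n_le_N).
set a := alg_connectivity G in a_gt0 *.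
set b := alg_connectivity GD in b_gt0 b_le *.
have sum_sqr : \sum_i phi 0 i ^+ 2 = 1.
  rewrite -(@sqr_sqrtr _ (\sum_i _)) ?[Num.sqrt _]phi_norm ?expr1n //.
  by apply: sumr_ge0 => i _; apply: sqr_ge0.
have eig : phi *m laplacian G = a *: phi.
  by apply/eigenspaceP; case: phi_fiedler.
have form_phi (v : 'rV_n) : lap_form G phi v = a * \sum_i phi 0 i * v 0 i.
  rewrite -laplacianP eig -scalemxAl mxE mxE; congr (_ * _).
  by apply: eq_bigr => i _; rewrite mxE.
(* Pairing [phi] with the all-ones vector gives [a] times its sum, yet the energy form vanishes
   there, and [a] is positive. *)
have sum_phi : \sum_i phi 0 i = 0.
  apply/eqP; have /eqP := lap_form_const G phi 1.
  rewrite form_phi mulf_eq0 gt_eqF //=; congr (_ == _).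
  by apply: eq_bigr => i _; rewrite mxE mulr1.
have pullback_sum (f : R -> R) : \sum_x f (phi 0 (p x)) = \sum_i f (phi 0 i)
    + \sum_(i < m) ((d i)%:R - 1) * f (phi 0 (widen_ord hmn i)).
  rewrite (sum_fibre p (fun k => f (phi 0 k))).
  rewrite -(sum_fibre_size hmn d (fun k => f (phi 0 k))).
  by apply: eq_bigr => k _; rewrite card_p.
(* The pullback of [phi] has sum [\sum_i g i], squared norm [1 + q] and mean [c]. *)
pose g i := ((d i)%:R - 1) * phi 0 (widen_ord hmn i).
pose q := \sum_(i < m) ((d i)%:R - 1) * phi 0 (widen_ord hmn i) ^+ 2.
pose c := N%:R^-1 * \sum_i g i.
have sumu : \sum_x phi 0 (p x) = \sum_i g i.
  by rewrite (pullback_sum id) sum_phi add0r.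
have sumu2 : \sum_x phi 0 (p x) ^+ 2 = 1 + q.
  by rewrite (pullback_sum (fun t => t ^+ 2)) sum_sqr.
(* Subtracting the mean makes the pullback orthogonal to the constants, so that the Rayleigh bound
   applies. *)
pose v : 'rV[R]_N := \row_x (phi 0 (p x) - c).
have sum_v : \sum_x v 0 x = 0.
  under eq_bigr => x _ do rewrite mxE.
  rewrite sumrB sumu sumr_const card_ord -[c *+ _]mulr_natl /c mulrA.
  by rewrite divff ?gt_eqF // mul1r subrr.
have norm_v : \sum_x v 0 x ^+ 2 = 1 + q - N%:R^-1 * (\sum_i g i) ^+ 2.
  have -> : \sum_x v 0 x ^+ 2
      = \sum_x (phi 0 (p x) ^+ 2 - (2 * c) * phi 0 (p x) + c ^+ 2).
    by apply: eq_bigr => x _; rewrite mxE; ring.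
  rewrite big_split sumrB /= -mulr_sumr sumu sumu2 sumr_const card_ord.
  by rewrite -[_ *+ N]mulr_natl /c; field; rewrite gt_eqF.
(* The shift by [c] leaves differences unchanged, so [v] has the energy of the unit eigenvector
   [phi]. *)
have form_v : lap_form GD v v = a.
  rewrite -[RHS]mulr1 -sum_sqr -form_phi.
  rewrite -(lap_form_pullback rep_p edge_rep weight_rep).
  apply: eq_bigr => x _; apply: eq_bigr => y _.
  by rewrite !mxE; ring.
rewrite ler_pdivlMr // mulrC -form_v; apply: le_trans (b_le v sum_v).
rewrite ler_pM2l // norm_v -addrA lerD2l.
have g_le := sqr_sum_le g.
rewrite -(ler_pM2l N_gt0) mulrBr !mulrA divff ?gt_eqF // !mul1r.
(* After Cauchy-Schwarz on the [m] terms [g i], the two sides agree term by term, since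
   [N - m (d i - 1) = n + nd - m (d i)]. *)
apply: le_trans (lerB (lexx _) g_le).
rewrite /q !mulr_sumr -sumrB; apply: ler_sum => i _.
by rewrite /g NE le_eqVlt; apply/orP; left; apply/eqP; ring.
Qed.
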